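(* Let $G=\Theta_{1,2,2}$, or $G=\Theta_{p,p,q}$ with integers $2\leq p\leq 3$ and $p\leq q\leq p+2$. Then $\mathrm{edim}(G)=3$.
   Context: All graphs are finite, simple and connected. For positive integers $p\le q\le r$ (with $q\ge 2$, so that the graph is simple), $\Theta_{p,q,r}$ denotes the graph consisting of two distinct vertices $u,v$ joined by three internally vertex-disjoint paths of lengths (numbers of edges) $p$, $q$ and $r$. For vertices $x,y$ of a graph $G$, $d(x,y)$ is the length of a shortest path between them; for a vertex $x$ and an edge $e=yz$, $d(x,e)=\min\{d(x,y),d(x,z)\}$. A vertex $s$ distinguishes two edges $e,e'$ if $d(s,e)\neq d(s,e')$. A set $S\subseteq V(G)$ is an edge metric generator if every pair of distinct edges of $G$ is distinguished by some $s\in S$. The edge metric dimension $\mathrm{edim}(G)$ is the size of a smallest edge metric generator of $G$. *)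

(* Defs.v *)
(* MathComp *)
From HB Require Import structures.
From mathcomp Require Import all_boot.

Set Implicit Arguments.
Unset Strict Implicit.
Unset Printing Implicit Defensive.

Record sgraph := SGraph {
  vertex :> finType;
  adj : rel vertex;
  adj_sym : symmetric adj;
  adj_irrefl : irreflexive adj }.

Section Metric.

Variable G : sgraph.
Implicit Types (x y s : G) (e : {set G}) (S : {set G}).

Definition edges : {set {set G}} :=
  [set [set xy.1; xy.2] | xy : G * G & adj xy.1 xy.2].

Definition graph_connected := forall x y, connect (@adj G) x y.

Definition has_path x y n :=
  [exists t : n.-tuple G,
     [&& path (@adj G) x t, last x t == y & uniq (x :: t)]].

(* The least n such that some path with n edges joins x to y.  A path has
   fewer than #|G| edges, so the search is exhaustive; the value is #|G| when
   x and y are not connected. *)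
Definition dist x y : nat := find (has_path x y) (iota 0 #|G|).

(* #|G| is an upper bound of dist, so starting from it does not affect the
   minimum over the two ends of an edge: see edge_dist2. *)
Definition edge_dist s e : nat := \big[minn/#|G|]_(x in e) dist s x.

Definition distinguishes s e e' := edge_dist s e != edge_dist s e'.

Definition edge_metric_generator S :=
  [forall e in edges, forall e' in edges, (e != e') ==>
     [exists s in S, distinguishes s e e']].

(* The whole vertex set is always a generator: see setT_generator. *)
Definition edim : nat :=
  #|[arg min_(S < [set: G] | edge_metric_generator S) #|S|]|.

Lemma dist_le_card x y : dist x y <= #|G|.
Proof. by rewrite -[leqRHS](size_iota 0) find_size. Qed.

Lemma dist_le x y t : path (@adj G) x t -> last x t = y -> dist x y <= size t.
Proof.
move=> + <-; case/shortenP => t' xt' ut' st'.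
have /andP[_ /uniq_leq_size/(_ st')] := ut'; apply: leq_trans.
have lt_t' : size t' < #|G|.
  by rewrite -[(size t').+1]/(size (x :: t')) -(card_uniqP ut') max_card.
rewrite leqNgt; apply/negP=> /(before_find 0).
suff -> : has_path x (last x t') (nth 0 (iota 0 #|G|) (size t')) by [].
rewrite nth_iota //; apply/existsP; exists (in_tuple t').
by apply/and3P; split.
Qed.

Lemma dist_path x y : connect (@adj G) x y ->
  exists t, [/\ path (@adj G) x t, last x t = y, uniq (x :: t)
              & size t = dist x y].
Proof.
case/connectP=> t0 /shortenP[t xt ut _] ->.
have lt_t : size t < #|G|.
  by rewrite -[(size t).+1]/(size (x :: t)) -(card_uniqP ut) max_card.
have : has (has_path x (last x t)) (iota 0 #|G|).
  apply/hasP; exists (size t); first by rewrite mem_iota.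
  by apply/existsP; exists (in_tuple t); apply/and3P.
move=> has_n; have := nth_find 0 has_n.
rewrite nth_iota ?add0n; last by rewrite -{2}(size_iota 0 #|G|) -has_find.
case/existsP=> t' /and3P[xt' /eqP last_t' ut'].
by exists t'; split; rewrite // size_tuple.
Qed.

Lemma leq_edge_dist n s e :
  (n <= edge_dist s e) = (n <= #|G|) && [forall x in e, n <= dist s x].
Proof.
rewrite -big_andE /edge_dist.
have [le_nG|lt_Gn] /= := leqP n #|G|.
  apply: (big_rec2 (fun m b => (n <= m) = b)) => // x b m _ <-.
  by rewrite leq_min.
apply/negbTE; rewrite -ltnNge.
elim/big_rec: _ => // x m _; exact: leq_ltn_trans (geq_minr _ _).
Qed.

Lemma edge_dist2 s x y :
  edge_dist s [set x; y] = minn (dist s x) (dist s y).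
Proof.
apply/eqP; rewrite eqn_leq; apply/andP; split; last first.
  rewrite leq_edge_dist geq_min dist_le_card; apply/forall_inP=> z.
  by rewrite !inE geq_min => /orP[]/eqP->; rewrite leqnn ?orbT.
have := leqnn (edge_dist s [set x; y]); rewrite {1}leq_edge_dist.
case/andP=> _ /forall_inP le_e.
by rewrite leq_min !le_e ?set21 ?set22.
Qed.

Lemma dist_eq0 x y : (dist x y == 0) = (x == y).
Proof.
apply/eqP/eqP => [d0|<-]; last first.
  by apply/eqP; rewrite -leqn0; apply: (@dist_le x x [::]).
have G_gt0 : 0 < #|G| by apply/card_gt0P; exists x.
have : has (has_path x y) (iota 0 #|G|).
  by rewrite has_find size_iota -/(dist x y) d0.
move/(nth_find 0); rewrite -/(dist x y) d0 nth_iota //.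
by case/existsP=> t; rewrite (tuple0 t) /= => /andP[/eqP].
Qed.

Lemma setT_generator : edge_metric_generator [set: G].
Proof.
have d0 s a b : (edge_dist s [set a; b] == 0) = (s \in [set a; b]).
  rewrite edge_dist2 !inE -!dist_eq0.
  by case: (dist s a) (dist s b) => [|m] [|n];
     rewrite ?minn0 ?min0n // minnSS.
apply/forall_inP=> _ /imsetP[[a b] _ ->] /=.
apply/forall_inP=> _ /imsetP[[c d] _ ->] /=; apply/implyP.
apply: contraNT; rewrite negb_exists => /forallP no_s.
apply/eqP/setP=> s; rewrite -!d0.
by have:= no_s s; rewrite inE /= negbK => /eqP->.
Qed.

Lemma edimP n : edim = n <->
  (exists2 S, edge_metric_generator S & #|S| = n)
  /\ (forall S, edge_metric_generator S -> n <= #|S|).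
Proof.
rewrite /edim; case: arg_minnP => [|S genS minS]; first exact: setT_generator.
split=> [<-|[[S' genS' <-] minS']]; first by split; first by exists S.
by apply/eqP; rewrite eqn_leq minS ?minS'.
Qed.

End Metric.

Definition consecutive (T : eqType) (s : seq T) (x y : T) :=
  (x, y) \in zip s (behead s).

Section Theta.

Variables p q r : nat.

(* A path with l >= 1 edges has l.-1 internal vertices, and the three paths
   share only their ends. *)
Inductive theta_vertex :=
  | Theta_u | Theta_v
  | Theta_p of 'I_p.-1 | Theta_q of 'I_q.-1 | Theta_r of 'I_r.-1.

Definition theta_code x : bool + ('I_p.-1 + 'I_q.-1 + 'I_r.-1) :=
  match x with
  | Theta_u => inl false | Theta_v => inl true
  | Theta_p i => inr (inl (inl i)) | Theta_q i => inr (inl (inr i))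
  | Theta_r i => inr (inr i)
  end.

Definition theta_decode (c : bool + ('I_p.-1 + 'I_q.-1 + 'I_r.-1)) :=
  match c with
  | inl false => Theta_u | inl true => Theta_v
  | inr (inl (inl i)) => Theta_p i | inr (inl (inr i)) => Theta_q i
  | inr (inr i) => Theta_r i
  end.

Lemma theta_codeK : cancel theta_code theta_decode.
Proof. by case. Qed.

HB.instance Definition _ := Finite.copy theta_vertex (can_type theta_codeK).

Definition theta_paths : seq (seq theta_vertex) :=
  [:: Theta_u :: rcons [seq Theta_p i | i <- enum 'I_p.-1] Theta_v;
      Theta_u :: rcons [seq Theta_q i | i <- enum 'I_q.-1] Theta_v;
      Theta_u :: rcons [seq Theta_r i | i <- enum 'I_r.-1] Theta_v].

Definition theta_adj (x y : theta_vertex) :=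
  has (fun s => consecutive s x y || consecutive s y x) theta_paths.

Lemma theta_adj_sym : symmetric theta_adj.
Proof. by move=> x y; apply: eq_has => s; rewrite orbC. Qed.

Lemma theta_paths_uniq : all uniq theta_paths.
Proof.
have uniq_path n (f : 'I_n -> theta_vertex) : injective f ->
    (forall i, f i != Theta_u) -> (forall i, f i != Theta_v) ->
    uniq (Theta_u :: rcons [seq f i | i <- enum 'I_n] Theta_v).
  move=> inj_f f_u f_v; rewrite /= mem_rcons inE /= rcons_uniq.
  rewrite (map_inj_uniq inj_f) enum_uniq andbT.
  by apply/andP; split; apply/mapP=> -[i _ /esym/eqP]; apply/negP.
by rewrite /= -!/(uniq (_ :: _)) !uniq_path // => i j [].
Qed.

Lemma theta_adj_irrefl : irreflexive theta_adj.
Proof.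
have consecF (T : eqType) (s : seq T) x : uniq s -> consecutive s x x = false.
  rewrite /consecutive; elim: s => // a [|b s] IHs //= /andP[nab /IHs/= nxx].
  rewrite inE nxx orbF; apply/eqP=> -[-> xb].
  by rewrite xb mem_head in nab.
move=> x; apply/hasP=> -[s /(allP theta_paths_uniq) us].
by rewrite orbb consecF.
Qed.

Definition Theta : sgraph := SGraph theta_adj_sym theta_adj_irrefl.

Lemma Theta_connected : graph_connected Theta.
Proof.
have consec_path (T : eqType) (a : T) s (e : rel T) :
    (forall x y, consecutive (a :: s) x y -> e x y) -> path e a s.
  elim: s a => //= b s IHs a e_as; rewrite e_as /=; last exact: mem_head.
  apply: IHs => x y xy; apply: e_as.
  by rewrite /consecutive inE [X in _ || X]xy orbT.
have adj_path s : Theta_u :: s \in theta_paths -> path theta_adj Theta_u s.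
  move=> s_in; apply: consec_path => x y xy.
  by apply/hasP; exists (Theta_u :: s) => //; rewrite xy.
have conn s x : Theta_u :: s \in theta_paths -> x \in Theta_u :: s ->
    connect theta_adj Theta_u x.
  by move=> /adj_path us; apply: path_connect.
have conn_u x : connect theta_adj Theta_u x.
  have enumP n (f : 'I_n -> theta_vertex) i :
      f i \in Theta_u :: rcons [seq f j | j <- enum 'I_n] Theta_v.
    by rewrite inE mem_rcons inE map_f ?mem_enum ?orbT.
  case: x => [||i|i|i]; first exact: connect0.
  - apply: conn (mem_head _ _) _.
    by rewrite inE mem_rcons mem_head orbT.
  - exact: conn (mem_head _ _) (enumP _ _ i).
  - by apply: conn (enumP _ _ i); rewrite !inE eqxx orbT.
  - by apply: conn (enumP _ _ i); rewrite !inE eqxx !orbT.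
move=> x y; apply: connect_trans (conn_u y).
by rewrite (sym_connect_sym theta_adj_sym).
Qed.

End Theta.

(* Main.v *)
Require Import Defs.
From mathcomp Require Import all_boot.

(** The statement concerns seven graphs with at most ten vertices, so it is
    decided by computation.  What has to be proved is that the computation
    computes the right thing.

    Let [el] list the edges of a connected graph.  The ball of radius [k]
    around [s] arises from [s] by adding neighbours [k] times ([mem_ball]), and
    the distance from [s] to an edge is the least radius for which the ball
    meets that edge.  This turns the distances from [s] to all edges into an
    explicit list of numbers ([edge_rowE]).  A set is an edge metric generator
    if and only if, over the edges in [el], the tuples of distances to its
    members are pairwise distinct ([edge_metric_generatorE]).

    The edge metric dimension is thus 3 as soon as, for all vertices [a] and
    [b], two distinct edges have the same distances to [a] and to [b], while
    some three vertices separate all edges ([edim_eq3]).  For theta graphs, the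
    edges are the consecutive pairs along the three paths, and both conditions
    are evaluated for each of the seven graphs. *)

Set Implicit Arguments.
Unset Strict Implicit.
Unset Printing Implicit Defensive.

(** * Lists and pairs *)

Lemma uniq_map_inj (T1 T2 : eqType) (f : T1 -> T2) (s : seq T1) :
  uniq (map f s) -> {in s &, injective f}.
Proof.
elim: s => //= a s IHs /andP[nfa /IHs inj_s] x y.
rewrite !inE => /predU1P[->|xs] /predU1P[->|ys] // fxy; last exact: inj_s.
- by rewrite fxy map_f in nfa.
- by rewrite -fxy map_f in nfa.
Qed.

(** If [m] is the first index at which [P] holds along the iterates of [f], and
    [P] holds from then on, then [find] returns [m]. *)
Lemma find_traject (T : Type) (f : T -> T) x (P : pred T) m n : m < n ->
  (forall k, P (iter k f x) = (m <= k)) -> find P (traject f x n) = m.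
Proof.
elim: n m x => // n IHn m x lt_mn Pm /=; rewrite (Pm 0).
case: m lt_mn Pm => //= m lt_mn Pm; congr _.+1.
by apply: IHn => // k; rewrite -iterSr Pm.
Qed.

Lemma set2_inj_oriented (T : finType) (s : seq (T * T)) :
    all (fun e => (e.2, e.1) \notin s) s ->
  {in s &, injective (fun e => [set e.1; e.2])}.
Proof.
move=> /allP no_rev [a b] [c d] ab cd /= eq_set.
have := set22 a b; have := set21 a b; rewrite eq_set.
(* If the pairs differ, then either one is the reverse of the other, or
   [a = b] and the first pair is its own reverse. *)
case/set2P=> eq_a /set2P[] eq_b; subst => //;
  by have := no_rev _ ab; rewrite /= ?ab ?cd.
Qed.

(** * Edge metric generators of a graph given by a list of edges *)

Section EdgeList.

Variables (G : sgraph) (el : seq (G * G)) (vs : seq G).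

Hypothesis G_conn : graph_connected G.
Hypothesis vsP : forall x, x \in vs.
Hypothesis adjE : forall x y : G, adj x y = ((x, y) \in el) || ((y, x) \in el).

(** No edge is listed with both orientations. *)
Hypothesis el_inj : {in el &, injective (fun e => [set e.1; e.2])}.

Implicit Types (x y s : G) (e : G * G) (S : {set G}).

(** The closed neighbourhood of a list of vertices, without repetitions. *)
Definition grow (B : seq G) : seq G :=
  undup (B ++ [seq e.2 | e <- el & e.1 \in B]
           ++ [seq e.1 | e <- el & e.2 \in B]).

Lemma mem_grow B y :
  reflect (y \in B \/ exists2 x, x \in B & adj x y) (y \in grow B).
Proof.
rewrite mem_undup !mem_cat; apply: (iffP or3P).
  case=> [yB|/mapP[[a b]]|/mapP[[a b]]]; first by left.
  - rewrite mem_filter /= => /andP[aB abe] ->; right; exists a => //.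
    by rewrite adjE abe.
  - rewrite mem_filter /= => /andP[bB abe] ->; right; exists b => //.
    by rewrite adjE abe orbT.
case=> [yB|[x xB]]; first by constructor 1.
rewrite adjE => /orP[xy|yx].
  by constructor 2; apply/mapP; exists (x, y); rewrite // mem_filter xB.
by constructor 3; apply/mapP; exists (y, x); rewrite // mem_filter xB.
Qed.

Lemma mem_ball k x y :
  reflect (exists t, [/\ path (@adj G) x t, last x t = y & size t <= k])
          (y \in iter k grow [:: x]).
Proof.
elim: k y => [|k IHk] y.
  rewrite inE; apply: (iffP eqP) => [->|[[|z t] [_ //]]]; by exists [::].
apply: (iffP (mem_grow _ _)).
  case=> [/IHk[t [xt ty le_tk]]|[z /IHk[t [xt tz le_tk]] zy]].
    by exists t; rewrite xt ty leqW.
  by exists (rcons t y); rewrite rcons_path xt tz zy last_rcons size_rcons.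
case=> t; case/lastP: t => [|t z] [].
  by move=> _ /= xy _; left; apply/IHk; exists [::].
rewrite rcons_path last_rcons size_rcons => /andP[xt tz] zy le_tk.
rewrite -zy; right; exists (last x t) => //.
by apply/IHk; exists t.
Qed.

Lemma mem_ball_dist k x y : (y \in iter k grow [:: x]) = (dist x y <= k).
Proof.
apply/mem_ball/idP => [[t [xt ty le_tk]]|le_k].
  exact: leq_trans (dist_le xt ty) le_tk.
have [t [xt ty _ sz_t]] := dist_path (G_conn x y).
by exists t; rewrite sz_t.
Qed.

Lemma dist_lt_size x y : dist x y < size vs.
Proof.
have [t [_ _ ut <-]] := dist_path (G_conn x y).
exact: (@uniq_leq_size _ (x :: t) vs).
Qed.

(** The distances from [s] to the edges in [el], read off the successive balls
    around [s].  The number of vertices bounds the radii to be considered. *)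
Definition edge_row s : seq nat :=
  let bs := traject grow [:: s] (size vs) in
  [seq find (fun B => (e.1 \in B) || (e.2 \in B)) bs | e <- el].

Lemma edge_rowE s : edge_row s = [seq edge_dist s [set e.1; e.2] | e <- el].
Proof.
apply: eq_map => e /=; rewrite edge_dist2; apply: find_traject => [|k].
  by rewrite gtn_min dist_lt_size.
by rewrite geq_min !mem_ball_dist.
Qed.

Lemma mem_edgesP E :
  reflect (exists2 e, e \in el & E = [set e.1; e.2]) (E \in edges G).
Proof.
apply: (iffP imsetP) => [[[x y]]|[[x y] xye ->]].
  rewrite inE /= adjE => /orP[xy|yx] ->; first by exists (x, y).
  by exists (y, x) => //=; rewrite setUC.
by exists (x, y); rewrite // inE /= adjE xye.
Qed.

(** Here [f e] stands for the tuple of distances from the vertices in [S] to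
    the edge [e], in whatever way it is represented. *)
Lemma edge_metric_generatorE (T : eqType) (f : G * G -> T) S :
    (forall e e', f e = f e' <->
       {in S, forall s, edge_dist s [set e.1; e.2]
                        = edge_dist s [set e'.1; e'.2]}) ->
  uniq el -> edge_metric_generator S = uniq [seq f e | e <- el].
Proof.
move=> fP u_el; apply/idP/idP => [genS|/uniq_map_inj inj_f].
  rewrite map_inj_in_uniq // => e e' e_in e'_in /fP eq_d.
  apply: el_inj => //; apply/eqP.
  have /forall_inP/(_ [set e.1; e.2]) := genS.
  have -> : [set e.1; e.2] \in edges G by apply/mem_edgesP; exists e.
  move=> /(_ isT)/forall_inP/(_ [set e'.1; e'.2]).
  have -> : [set e'.1; e'.2] \in edges G by apply/mem_edgesP; exists e'.
  move=> /(_ isT); apply: contraTT => ne; rewrite ne /=.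
  by apply/exists_inPn => s sS; rewrite /distinguishes eq_d ?eqxx.
apply/forall_inP=> _ /mem_edgesP[e e_in ->].
apply/forall_inP=> _ /mem_edgesP[e' e'_in ->]; apply/implyP.
apply: contraNT => /exists_inPn eq_d; apply/eqP.
have -> // : e = e'.
by apply: inj_f => //; apply/fP => s /eq_d; rewrite negbK => /eqP.
Qed.

Lemma edge_metric_generator_sub S S' :
  S \subset S' -> edge_metric_generator S -> edge_metric_generator S'.
Proof.
move=> /subsetP sSS' /forall_inP genS; apply/forall_inP=> e e_in.
apply/forall_inP=> e' e'_in; apply/implyP=> ne.
have /forall_inP/(_ e' e'_in)/implyP/(_ ne)/exists_inP[s sS sP] := genS e e_in.
by apply/exists_inP; exists s; first exact: sSS'.
Qed.

Lemma generator2 a b : uniq el ->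
  edge_metric_generator [set a; b] = uniq (zip (edge_row a) (edge_row b)).
Proof.
move=> u_el; rewrite !edge_rowE zip_map; apply: edge_metric_generatorE => //.
move=> e e'; split=> [[eq_a eq_b] s|eq_d].
  by rewrite !inE => /orP[]/eqP->.
by rewrite !eq_d // !inE eqxx ?orbT.
Qed.

Lemma generator3 a b c : uniq el ->
  edge_metric_generator [set a; b; c]
    = uniq (zip (edge_row a) (zip (edge_row b) (edge_row c))).
Proof.
move=> u_el; rewrite !edge_rowE !zip_map.
apply: edge_metric_generatorE => // e e'.
split=> [[eq_a eq_b eq_c] s|eq_d]; last by rewrite !eq_d // !inE eqxx ?orbT.
by rewrite !inE -orbA => /or3P[]/eqP->.
Qed.

Lemma card_le2 S : vs != [::] -> #|S| <= 2 -> exists a b, S \subset [set a; b].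
Proof.
(* The default [x0] completes the list of members of [S] if it is too short. *)
case: vs => // x0 _ _ S_le2; exists (nth x0 (enum S) 0), (nth x0 (enum S) 1).
apply/subsetP => x; rewrite -mem_enum => /(nthP x0)[i + <-].
rewrite -cardE => /leq_trans/(_ S_le2).
by case: i => [|[|]] // _; rewrite !inE eqxx ?orbT.
Qed.

(** No two vertices separate all edges, but some three do.  The list of rows is
    an argument so that it is computed only once. *)
Definition separated_by_3_not_2 (rows : seq (seq nat)) : bool :=
  all (fun ra => all (fun rb => ~~ uniq (zip ra rb)) rows) rows
  && has (fun ra => has (fun rb => has (fun rc =>
       uniq (zip ra (zip rb rc))) rows) rows) rows.

Lemma edim_eq3 :
  uniq el -> separated_by_3_not_2 (map edge_row vs) -> edim G = 3.
Proof.
move=> u_el /andP[/allP no2 has3].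
have ge3 S : edge_metric_generator S -> 3 <= #|S|.
  move=> genS; rewrite ltnNge; apply/negP=> /card_le2[|a [b sSab]].
    by case: vs has3.
  have /allP/(_ (edge_row b)) := no2 (edge_row a) (map_f _ (vsP a)).
  rewrite map_f // => /(_ isT); rewrite -generator2 //.
  by rewrite (edge_metric_generator_sub sSab).
have [_ /mapP[a _ ->]] := hasP has3.
case/hasP=> _ /mapP[b _ ->] /hasP[_ /mapP[c _ ->]].
rewrite -generator3 // => gen3; apply/edimP; split=> //.
exists [set a; b; c] => //; apply/eqP; rewrite eqn_leq ge3 // andbT.
by rewrite -setUA !cardsU1 cards1; do 2!case: (_ \notin _).
Qed.

End EdgeList.

(** * Theta graphs *)

Section ThetaEdges.

Variables p q r : nat.

(** An enumeration of ['I_n] that evaluates, unlike [enum 'I_n]. *)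
Fixpoint ord_list n : seq 'I_n :=
  if n is n'.+1 then ord0 :: map (lift ord0) (ord_list n') else [::].

Lemma ord_listE n : ord_list n = enum 'I_n.
Proof.
elim: n => [|n IHn] /=; last by rewrite enum_ordSl IHn.
by apply/esym/size0nil; rewrite size_enum_ord.
Qed.

(** The paths of the theta graph, in a form that evaluates. *)
Definition theta_path_list : seq (seq (Theta p q r)) :=
  let path_via vs := Theta_u p q r :: rcons vs (Theta_v p q r) in
  [:: path_via (map (@Theta_p p q r) (ord_list p.-1));
      path_via (map (@Theta_q p q r) (ord_list q.-1));
      path_via (map (@Theta_r p q r) (ord_list r.-1))].

Lemma theta_path_listE : theta_path_list = theta_paths p q r.
Proof. by rewrite /theta_path_list !ord_listE. Qed.

(** Each edge is listed with the orientation of its path from [u] to [v]. *)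
Definition theta_edge_list : seq (Theta p q r * Theta p q r) :=
  flatten [seq zip s (behead s) | s <- theta_path_list].

Definition theta_vertex_list : seq (Theta p q r) :=
  undup (flatten theta_path_list).

Lemma theta_adjE (x y : Theta p q r) :
  adj x y = ((x, y) \in theta_edge_list) || ((y, x) \in theta_edge_list).
Proof.
have mem_el a b : ((a, b) \in theta_edge_list)
    = has (fun s => consecutive s a b) (theta_paths p q r).
  rewrite /theta_edge_list theta_path_listE; apply/flatten_mapP/hasP;
    by case=> s s_in ab; exists s.
by rewrite !mem_el -has_predU.
Qed.

Lemma mem_theta_vertex_list x : x \in theta_vertex_list.
Proof.
rewrite mem_undup theta_path_listE; apply/flattenP.
case: x => [||i|i|i].
- by exists (head [::] (theta_paths p q r)); rewrite mem_head.
- exists (head [::] (theta_paths p q r)); rewrite ?mem_head //= !inE.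
  by rewrite mem_rcons mem_head orbT.
- exists (nth [::] (theta_paths p q r) 0); first exact: mem_nth.
  by rewrite /= inE mem_rcons inE map_f ?mem_enum ?orbT.
- exists (nth [::] (theta_paths p q r) 1); first exact: mem_nth.
  by rewrite /= inE mem_rcons inE map_f ?mem_enum ?orbT.
- exists (nth [::] (theta_paths p q r) 2); first exact: mem_nth.
  by rewrite /= inE mem_rcons inE map_f ?mem_enum ?orbT.
Qed.

(** The second condition forbids listing an edge with both orientations. *)
Definition theta_check : bool :=
  [&& uniq theta_edge_list,
      all (fun e => (e.2, e.1) \notin theta_edge_list) theta_edge_list
    & separated_by_3_not_2
        (map (edge_row theta_edge_list theta_vertex_list) theta_vertex_list)].

Lemma theta_checkP : theta_check -> edim (Theta p q r) = 3.
Proof.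
case/and3P=> u_el no_rev sep.
apply: edim_eq3 u_el sep.
- exact: Theta_connected.
- exact: mem_theta_vertex_list.
- exact: theta_adjE.
- exact: set2_inj_oriented.
Qed.

End ThetaEdges.

Theorem proposition11 :
  edim (Theta 1 2 2) = 3 /\
  (forall p q : nat, 2 <= p <= 3 -> p <= q <= p + 2 ->
     edim (Theta p p q) = 3).
Proof.
split=> [|p q]; first by apply: theta_checkP; vm_compute.
case: p => [|[|[|[|p]]]] // _; case: q => [|[|[|[|[|[|q]]]]]] // _.
all: by apply: theta_checkP; vm_compute.
Qed.
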